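(* Let $G$ be a unicyclic graph with $n \ge 4$ vertices and maximum degree $\Delta \ge 3$, let $q=\lfloor \frac{n}{\Delta-1}\rfloor$, and let $f : [1,\infty) \to \mathbb{R}$ be a concave function. If $q=1$ or $n=2\Delta-2$, then $$ I_f(G) \ge f(\Delta) + f(n-\Delta+1) + f(2) + (n-3) f(1). $$ If $q>1$ and $n\ne 2\Delta-2$, then $$ I_f(G) \ge q f(\Delta) + f\big(n-q(\Delta-1)+1\big) + (n-q-1) f(1). $$ The inequalities are attained (i.e., equality holds in the respective case) if and only if $G \in \mathcal{K}_n^\Delta$.
   Context: All graphs are finite, connected, simple (no loops, no multiple edges) and have at least one edge. A unicyclic graph is a graph containing exactly one cycle. For a vertex $u$ of $G$, $d_u$ denotes its degree. For a function $f:[1,\infty)\to\mathbb{R}$, $I_f(G) = \sum_{u\in V(G)} f(d_u)$. For $n\ge 4$, $3\le\Delta\le n-1$ and $q=\lfloor \frac{n}{\Delta-1}\rfloor$, define the $n$-tuple $\mathbf{z}$ as follows. If $q=1$ or $n=2\Delta-2$, then $\mathbf{z}=(\Delta,\,n-\Delta+1,\,2,\,1,\dots,1)$ with $n-3$ entries equal to $1$ at the end. If $q\ge 2$ and $n\ne 2\Delta-2$, then $\mathbf{z}=(z_1,\dots,z_n)$ with $z_j=\Delta$ for $1\le j\le q$, $z_{q+1}=n-q(\Delta-1)+1$, and $z_j=1$ for $q+1<j\le n$. $\mathcal{K}_n^\Delta$ is the set of unicyclic graphs with $n$ vertices whose degree sequence (in non-increasing order) is $\mathbf{z}$.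
   Formalization: The direction ''equality holds only if G is in K'' is stated for strictly concave f, since it fails for affine f (f(x)=x, n=5, Δ=3, G = 4-cycle with a pendant vertex); the inequalities and ''G in K implies equality'' are for all concave f. *)

(* Defs.v *)
From mathcomp Require Import all_boot all_order all_algebra.
From mathcomp Require Import boolp classical_sets set_interval reals convex.

Set Implicit Arguments.
Unset Strict Implicit.
Unset Printing Implicit Defensive.

Import Order.TTheory GRing.Theory Num.Theory.

Record sgraph := SGraph {
  vertex :> finType;
  adj : rel vertex;
  adj_sym : symmetric adj;
  adj_irr : irreflexive adj
}.

Section Graphs.
Variable G : sgraph.

Definition deg (u : G) : nat := #|[pred v | adj u v]|.

Definition maxdeg : nat := \max_(u : G) deg u.

Definition degree_sequence : seq nat := sort geq [seq deg u | u : G].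

Definition graph_connected : Prop := forall u v : G, connect (@adj G) u v.

(* A cycle is a subgraph, identified with its edge set; the rotations and the
   reversal of a cyclic sequence of vertices give the same cycle. *)
Definition cycle_edges (c : seq G) : {set {set G}} :=
  [set [set u; next c u] | u in c].

Definition is_cycle (C : {set {set G}}) : Prop :=
  exists c : seq G, [/\ 3 <= size c, ucycle (@adj G) c & C = cycle_edges c].

Definition unicyclic : Prop :=
  graph_connected /\ exists! C : {set {set G}}, is_cycle C.

End Graphs.

(* Only used for 4 <= n and 3 <= D <= n - 1, where the subtractions are
   exact and z has n entries. *)
Definition zseq (n D : nat) : seq nat :=
  let q := n %/ (D - 1) in
  if (q == 1) || (n == 2 * D - 2) then [:: D; n - D + 1; 2] ++ nseq (n - 3) 1
  else nseq q D ++ (n - q * (D - 1) + 1) :: nseq (n - q - 1) 1.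

Definition in_K (n D : nat) (G : sgraph) : Prop :=
  [/\ unicyclic G, #|G| = n & degree_sequence G = zseq n D].

Local Open Scope ring_scope.

Definition I_f (R : realType) (f : R -> R) (G : sgraph) : R :=
  \sum_(u : G) f (deg u)%:R.

(* Functions on [1, +oo) are represented by f : R -> R; values outside that
   interval are unconstrained. *)
Definition concave (R : realType) (f : R -> R) : Prop :=
  convex_function (`[1, +oo[%classic : set R^o) (fun x => - f x).

Definition strictly_concave (R : realType) (f : R -> R) : Prop :=
  forall x y t : R, 1 <= x -> 1 <= y -> x != y -> 0 < t < 1 ->
    t * f x + (1 - t) * f y < f (t * x + (1 - t) * y).

(* Main.v *)
(* Deleting an edge of the unique cycle leaves a spanning tree, so the degrees
   sum to 2n; they are positive, and at least three of them exceed 1.  By Abel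
   summation, the sum of f over a list s of degrees is size s * f 1 plus the
   sum over j >= 1 of (f (j + 1) - f j) * N_j, where N_j is the number of
   entries of s above j.  The increments of f decrease with j, the sum of the
   N_j is n both for the degrees of G and for z, and N_j(G) - N_j(z) changes
   sign at most once, from + to -, as j grows: N_j(z) is k or k + 1 for a fixed
   k, except that in the first case N_1(z) = 3, which N_1(G) is at least. *)
Require Import Defs.
From mathcomp Require Import all_boot all_order all_algebra.
From mathcomp Require Import boolp interval_inference reals convex zify ring lra.

Set Implicit Arguments.
Unset Strict Implicit.
Unset Printing Implicit Defensive.

Import Order.TTheory GRing.Theory Num.Theory.

(** * Cycles, deleted edges and spanning trees *)

Definition del_edge {T : finType} (e : rel T) (x y : T) : rel T :=
  fun u v => e u v && ([set u; v] != [set x; y]).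

Lemma set2_eq (T : finType) (u v x y : T) :
  [set u; v] = [set x; y] -> (u = x /\ v = y) \/ (u = y /\ v = x).
Proof.
move=> E.
have /set2P hu : u \in [set x; y] by rewrite -E set21.
have /set2P hv : v \in [set x; y] by rewrite -E set22.
have /set2P hx : x \in [set u; v] by rewrite E set21.
have /set2P hy : y \in [set u; v] by rewrite E set22.
by case: hu => ?; case: hv => ?; case: hx => ?; case: hy => ?; subst; auto.
Qed.

Lemma del_edge_sym (T : finType) (e : rel T) (x y : T) :
  symmetric e -> symmetric (del_edge e x y).
Proof. by move=> se u v; rewrite /del_edge se setUC. Qed.

(** The deleted edge closes a simple path from [v] to [u]. That path has at least two steps: with
    none, [uv] would be a loop; with one, it would use the deleted edge. *)
Lemma connect_del_edge_cycle (T : finType) (e : rel T) (u v : T) :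
  irreflexive e -> e u v -> connect (del_edge e u v) v u ->
  exists2 c : seq T, 3 <= size c & ucycle e c.
Proof.
move=> ie euv /connectP[p0 /shortenP[p pp up _] lp].
have pe : path e v p by apply: sub_path pp => a b /andP[].
exists (v :: p); last first.
  by rewrite /ucycle up andbT /= rcons_path pe -lp euv.
case: p pp lp {up pe} => [|w [|w' p]] //=.
  by move=> _ uv; move: euv; rewrite uv ie.
by move=> /andP[/andP[_ /negP h] _] uw; case: h; rewrite uw setUC.
Qed.

Lemma path_del_edge_notin (T : finType) (e : rel T) (x y a : T) (p : seq T) :
  x \notin a :: p -> path e a p -> path (del_edge e x y) a p.
Proof.
move=> xp; apply: (@sub_in_path _ (mem (a :: p))); last exact/allP.
move=> u v up vp euv; rewrite /del_edge euv /=; apply/eqP => /set2_eq.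
by case=> -[? ?]; subst; rewrite ?up ?vp in xp.
Qed.

(** The rest of the cycle leads from [y] back to [x]. Only its last step touches [x], and that step
    does not start at [y], since [p] is nonempty. *)
Lemma connect_del_cycle_edge (T : finType) (e : rel T) (x y : T) (p : seq T) :
  2 <= size (y :: p) -> ucycle e [:: x, y & p] -> connect (del_edge e x y) y x.
Proof.
case: p => [|z p] // _ /andP[].
rewrite /= rcons_path => /and4P[exy eyz pz elx] /andP[xn /andP[yn _]].
apply/connectP; exists (rcons (z :: p) x); last by rewrite last_rcons.
rewrite rcons_path (@path_del_edge_notin _ _ _ _ _ (z :: p)) //=; last by rewrite eyz.
rewrite /del_edge elx /=; apply/eqP => /set2_eq.
have lz : last z p \in z :: p by rewrite mem_last.
case=> -[E _]; rewrite E in lz; last by rewrite lz in yn.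
by rewrite inE lz orbT in xn.
Qed.

Lemma connected_del_cycle_edge (T : finType) (e : rel T) (x y : T) (p : seq T) :
  symmetric e -> (forall u v, connect e u v) ->
  2 <= size (y :: p) -> ucycle e [:: x, y & p] ->
  forall u v, connect (del_edge e x y) u v.
Proof.
move=> se ce sp /(connect_del_cycle_edge sp) yx u v.
apply: connect_sub (ce u v) => a b eab.
have [E|E] := eqVneq [set a; b] [set x; y]; last first.
  by apply: connect1; rewrite /del_edge eab.
have cs := sym_connect_sym (del_edge_sym x y se).
by case: (set2_eq E) => -[-> ->] //; rewrite cs.
Qed.

(* A breadth-first tree: p is the parent map and h the distance to the root. *)
Lemma spanning_tree (T : finType) (e : rel T) (r : T) :
  (forall v, connect e v r) ->
  exists h : T -> nat, exists p : T -> T,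
    forall v, v != r -> e v (p v) /\ h (p v) < h v.
Proof.
move=> ce.
pose P v k := `[< exists s, [/\ path e v s, last v s = r & size s = k] >].
have exP v : exists k, P v k.
  by have /connectP[s ps ls] := ce v; exists (size s); apply/asboolP; exists s.
exists (fun v => ex_minn (exP v)).
(* [choice] asks for a value at the root too, so [v != r] stands under the existential. *)
suff /choice[p hp] : forall v, exists w, v != r ->
    e v w /\ ex_minn (exP w) < ex_minn (exP v) by exists p.
move=> v; case: ex_minnP => k /asboolP[[|w s] [ps ls sk] _].
  by exists v => /eqP; case.
exists w => _; move: ps => /= /andP[-> ps]; split=> //.
(* The tail of a shortest path from [v] is a path from [w] with one step fewer. *)
case: ex_minnP => m _ mm; rewrite -sk ltnS; apply: mm.
by apply/asboolP; exists s.
Qed.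

Lemma connect_root (T : finType) (e : rel T) (r : T) (h : T -> nat) (p : T -> T) :
  (forall v, v != r -> e v (p v) /\ h (p v) < h v) ->
  forall v, connect e v r.
Proof.
move=> H v; have [k] := ubnP (h v); elim: k v => // k IH v; rewrite ltnS => hk.
have [->|/H[ev hv]] := eqVneq v r; first exact: connect0.
by apply: connect_trans (connect1 ev) (IH _ _); exact: leq_trans hv hk.
Qed.

(** Each vertex other than the root contributes the arc to its parent and the reverse arc;
    acyclicity excludes all others. Ordered pairs are counted because that number is the sum of the
    degrees. *)
Lemma tree_arcs (T : finType) (e : rel T) :
  symmetric e -> irreflexive e -> 0 < #|T| -> (forall u v, connect e u v) ->
  (forall c, 3 <= size c -> ~ ucycle e c) ->
  #|[set a : T * T | e a.1 a.2]| = 2 * (#|T| - 1).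
Proof.
move=> se ie T0 ce ac.
have /card_gt0P[r _] := T0.
have [h [p H]] := spanning_tree (fun v => ce v r).
pose up := [set (v, p v) | v in [set~ r]]; pose dn := [set (p v, v) | v in [set~ r]].
have -> : [set a : T * T | e a.1 a.2] = up :|: dn.
  apply/setP => -[u v]; rewrite !inE /=; apply/idP/idP; last first.
    by case/orP => /imsetP[w]; rewrite !inE => /H[ew _] [-> ->] //; rewrite se.
  (* Without a non-tree edge uv the graph is still connected, so uv would lie
     on a cycle. *)
  move=> euv; apply: contraT; rewrite negb_or => /andP[nup ndn].
  have H' w : w != r -> del_edge e u v w (p w) /\ h (p w) < h w.
    move=> wr; have [ew hw] := H w wr; split=> //; rewrite /del_edge ew /=.
    apply/eqP => /set2_eq[] [E1 E2].
      by case/negP: nup; apply/imsetP; exists w; rewrite ?inE // E2 E1.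
    by case/negP: ndn; apply/imsetP; exists w; rewrite ?inE // E2 E1.
  have cr := connect_root H'.
  have cs := sym_connect_sym (del_edge_sym u v se).
  have vu : connect (del_edge e u v) v u.
    by apply: connect_trans (cr v) _; rewrite cs.
  by have [c /ac] := connect_del_edge_cycle ie euv vu.
(* No arc is both upward and downward, since [h] would decrease in both directions. *)
rewrite cardsU (_ : up :&: dn = set0) ?cards0 ?subn0; last first.
  apply/setP => -[u v]; rewrite !inE; apply/negP.
  case/andP => /imsetP[w]; rewrite !inE => /H[_ hw] [-> ->] /imsetP[w'].
  rewrite !inE => /H[_ hw'] [E1 E2]; rewrite -E1 -E2 in hw'.
  by have := ltn_trans hw hw'; rewrite ltnn.
rewrite !card_imset ?cardsC1; last 2 first.
- by move=> a b [].
- by move=> a b [].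
lia.
Qed.

(** * Degrees in a unicyclic graph *)

Section Unicyclic.
Variable G : sgraph.

Lemma sum_deg : \sum_(u : G) deg u = #|[set a : G * G | adj a.1 a.2]|.
Proof.
rewrite -sum1dep_card -(pair_big_dep xpredT (@adj G) (fun _ _ => 1)) /=.
by apply: eq_bigr => u _; rewrite sum1_card.
Qed.

Lemma unicyclic_cycle : unicyclic G ->
  exists x y p, 2 <= size (y :: p) /\ ucycle (@adj G) [:: x, y & p].
Proof.
by case=> _ [C [[[|x [|y p]] [// sc uc _] _]]]; exists x, y, p.
Qed.

(** A remaining cycle is also a cycle of [G], so by uniqueness it has the same edge set as the given
    one and contains the deleted edge. *)
Lemma acyclic_del_cycle_edge (x y : G) (p : seq G) : unicyclic G ->
  2 <= size (y :: p) -> ucycle (@adj G) [:: x, y & p] ->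
  forall c, 3 <= size c -> ~ ucycle (del_edge (@adj G) x y) c.
Proof.
move=> [_ [C [_ uC]]] sp uxy c sc /andP[cc uc].
have Ec : C = cycle_edges c.
  apply: uC; exists c; split=> //; apply/andP; split=> //.
  by apply: sub_cycle cc => a b /andP[].
have Exy : C = cycle_edges [:: x, y & p] by apply: uC; exists [:: x, y & p].
have : [set x; y] \in cycle_edges [:: x, y & p].
  by apply/imsetP; exists x; rewrite ?mem_head //= eqxx.
rewrite -Exy Ec => /imsetP[u uin Eu].
by have /andP[_ /eqP] := next_cycle cc uin; rewrite -Eu.
Qed.

(** Both orientations of a cycle edge are added to the arcs of the spanning tree left by its
    deletion. *)
Lemma unicyclic_sum_deg : unicyclic G -> \sum_(u : G) deg u = 2 * #|G|.
Proof.
move=> uG; have [x [y [p [sp uxy]]]] := unicyclic_cycle uG.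
have sy := @adj_sym G; have ir := @adj_irr G.
have G0 : 0 < #|G| by apply/card_gt0P; exists x.
pose e := del_edge (@adj G) x y.
have axy : adj x y by case/andP: uxy => /= /andP[].
have ie : irreflexive e by move=> u; rewrite /e /del_edge ir.
have TA : #|[set a : G * G | e a.1 a.2]| = 2 * (#|G| - 1) :=
  tree_arcs (del_edge_sym x y sy) ie G0
  (connected_del_cycle_edge sy uG.1 sp uxy) (acyclic_del_cycle_edge uG sp uxy).
have nxy : x != y by apply/eqP => E; rewrite E ir in axy.
rewrite sum_deg (_ : [set a | _] = [set a | e a.1 a.2] :|: [set (x, y); (y, x)]).
  rewrite cardsU cards2 xpair_eqE negb_and nxy /= TA.
  rewrite (_ : _ :&: _ = set0) ?cards0; last first.
    apply/setP => -[u v]; rewrite !inE /= /e /del_edge.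
    apply/negP => /andP[/andP[_ /eqP nE] /orP[]] /eqP[E1 E2]; case: nE; subst => //.
    by rewrite setUC.
  by rewrite subn0 mulnBr muln1 subnK // leq_pmulr.
apply/setP => -[u v]; rewrite !inE /= /e /del_edge.
apply/idP/idP; last first.
  by case/orP => [/andP[]//|/orP[] /eqP[-> ->] //]; rewrite sy.
move=> auv; rewrite auv /=; case: eqVneq => //= /set2_eq.
by case=> -[-> ->]; rewrite eqxx ?orbT.
Qed.

Lemma connected_deg_gt0 (u : G) : graph_connected G -> 1 < #|G| -> 0 < deg u.
Proof.
move=> cG G1; have : 0 < #|predC1 u|.
  by have := cardC (pred1 u); rewrite card1 => E; move: G1; rewrite -E add1n ltnS.
case/card_gt0P => v; rewrite inE => vu.
have /connectP[[|w p] /= pp lv] := cG u v; first by rewrite lv eqxx in vu.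
by apply/card_gt0P; exists w; rewrite inE; case/andP: pp.
Qed.

Lemma deg_lt_card (u : G) : deg u < #|G|.
Proof.
have -> : #|G| = #|predC1 u|.+1 by rewrite -(cardC (pred1 u)) card1.
rewrite ltnS; apply: subset_leq_card; apply/subsetP => v; rewrite !inE => auv.
by apply/eqP => E; rewrite E adj_irr in auv.
Qed.

(** Once the cycle is rotated to start at [u], its second and last vertices are two distinct
    neighbours of [u]. *)
Lemma cycle_deg_ge2 (c : seq G) (u : G) :
  3 <= size c -> ucycle (@adj G) c -> u \in c -> 1 < deg u.
Proof.
move=> sc /andP[cc uc] uin; case: (rot_to uin) => i s E.
have ss : 2 <= size s by have := congr1 size E; rewrite size_rot /=; lia.
move: cc uc; rewrite -(rot_cycle i) -(rot_uniq i) E.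
case: s ss {E} => [|y [|z s]] //= _; rewrite rcons_path => /and4P[auy _ _ alu].
move=> /and3P[_ yn _]; set w := last z s.
have wy : y != w by apply: contra yn => /eqP->; exact: mem_last.
have <- : #|[set y; w]| = 2 by rewrite cards2 wy.
apply: subset_leq_card; apply/subsetP => v; rewrite !inE.
by case/orP => /eqP-> //; rewrite adj_sym.
Qed.

Lemma unicyclic_card_deg_ge2 : unicyclic G -> 3 <= #|[pred u : G | 1 < deg u]|.
Proof.
move=> uG; have [x [y [p [sp uxy]]]] := unicyclic_cycle uG.
apply: leq_trans (_ : #|[:: x, y & p]| <= _).
  by have /andP[_ /card_uniqP ->] := uxy.
apply: subset_leq_card; apply/subsetP => v vin; rewrite inE.
exact: cycle_deg_ge2 uxy vin.
Qed.

End Unicyclic.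

(** * Concavity at integers and Abel summation *)

Local Open Scope ring_scope.

(** Concavity enters the proof only in this form: the increments of [f] at positive integers do not
    increase. *)
Lemma concave_midpoint (R : realType) (f : R -> R) (j : nat) : concave f -> (0 < j)%N ->
  f j%:R + f j.+2%:R <= 2 * f j.+1%:R.
Proof.
move=> cf j0.
have h0 : (0 : R) <= 2^-1 by rewrite invr_ge0.
have h1 : (2^-1 : R) <= 1 by rewrite invf_le1 ?ler1n.
have := cf (Itv01 h0 h1) j%:R j.+2%:R.
rewrite !classical_sets.in_setE /= !in_itv /= !ler1n j0 => /(_ isT isT).
rewrite !convRE /= /unstable.onem [X in - f X](_ : _ = j.+1%:R); first lra.
have E : 2^-1 * j%:R + (1 - 2^-1) * j.+2%:R = j.+1%:R :> R.
  by rewrite -[j.+2]addn2 -[j.+1]addn1 !natrD; field.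
exact: E.
Qed.

Lemma strictly_concave_midpoint (R : realType) (f : R -> R) (j : nat) :
  strictly_concave f -> (0 < j)%N -> f j%:R + f j.+2%:R < 2 * f j.+1%:R.
Proof.
move=> cf j0.
have jj : j%:R != j.+2%:R :> R by rewrite eqr_nat; lia.
have h : (0 < 2^-1 :> R) && (2^-1 < 1 :> R) by apply/andP; split; lra.
have := cf j%:R j.+2%:R 2^-1 _ _ jj h; rewrite !ler1n j0 => /(_ isT isT).
have -> : 2^-1 * j%:R + (1 - 2^-1) * j.+2%:R = j.+1%:R :> R.
  by rewrite -[j.+2]addn2 -[j.+1]addn1 !natrD; field.
lra.
Qed.

(** The indicator of [j < x] makes the range independent of [x], so that summing over a list turns
    it into [count (ltn j)]. *)
Lemma telescope_sum_lt (V : zmodType) (D x : nat) (g : nat -> V) : (0 < x <= D)%N ->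
  g x = g 1%N + \sum_(1 <= j < D) (g j.+1 - g j) *+ (j < x)%N.
Proof.
move=> /andP[x0 xD]; rewrite (big_cat_nat x0 xD) /= [X in _ + (_ + X)]big_nat_cond.
rewrite [X in _ + (_ + X)]big1 ?addr0 => [|j]; last first.
  by case/andP => /andP[xj _] _; rewrite ltnNge xj mulr0n.
rewrite big_nat_cond; under eq_bigr => j /andP[/andP[_ ->] _] do rewrite mulr1n.
by rewrite -big_nat_cond telescope_sumr // addrC subrK.
Qed.

Lemma sum_abel (V : zmodType) (D : nat) (g : nat -> V) (s : seq nat) :
  all (fun x => 0 < x <= D)%N s ->
  \sum_(x <- s) g x = g 1%N *+ size s
    + \sum_(1 <= j < D) (g j.+1 - g j) *+ count (ltn j) s.
Proof.
elim: s => [|x s IH] /=.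
  by rewrite big_nil mulr0n big1 ?addr0 // => i _; rewrite mulr0n.
move=> /andP[xD /IH E]; rewrite big_cons E.
under [X in _ = _ + X]eq_bigr do rewrite mulrnDr.
by rewrite big_split /= mulrS addrACA; congr (_ + _); exact: telescope_sum_lt.
Qed.

(** The multiplicity of a positive value is the difference of two consecutive counts; that of 0
    comes from the size. *)
Lemma perm_eq_count_ltn (s t : seq nat) :
  (forall j, count (ltn j) s = count (ltn j) t) -> size s = size t -> perm_eq s t.
Proof.
move=> E sz; rewrite /perm_eq; apply/allP => x _ /=; apply/eqP.
have P (y : nat) (u : seq nat) : (count (pred1 y.+1) u + count (ltn y.+1) u = count (ltn y) u)%N.
  elim: u => //= z u <-; rewrite (leq_eqVlt y.+1) eq_sym.
  by case: eqP => [->|_]; rewrite ?ltnn /=; lia.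
have P0 (u : seq nat) : (count (pred1 0) u + count (ltn 0) u = size u)%N.
  elim: u => //= z u <-; case: z => [|z] /=; rewrite ?add0n ?add1n ?addSn ?addnS //.
case: x => [|x]; first by apply: (@addIn (count (ltn 0) s)); rewrite P0 E P0.
by apply: (@addIn (count (ltn x.+1) s)); rewrite P !E P.
Qed.

(** * Comparison of two lists with the same size and sum *)

Section Majorization.
Variables (R : realDomainType) (D k : nat) (s t : seq nat).
Hypotheses (hs : all (fun x => 0 < x <= D)%N s) (ht : all (fun x => 0 < x <= D)%N t).
Hypotheses (hsz : size s = size t) (hsum : \sum_(x <- s) x = \sum_(x <- t) x).
(** Where [s] has more than [k] entries above [j], the upper bound makes it have at least as many as
    [t]; elsewhere the lower bound makes it have at most as many. The [maxn] admits the exceptional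
    level 1 of the first case. *)
Hypothesis hk : forall j, (0 < j < D)%N ->
  (k <= count (ltn j) t <= maxn k.+1 (count (ltn j) s))%N.

Let a j : R := (count (ltn j) s)%:R - (count (ltn j) t)%:R.

Lemma sum_excess_diff (g : nat -> R) :
  \sum_(x <- s) g x - \sum_(x <- t) g x = \sum_(1 <= j < D) (g j.+1 - g j) * a j.
Proof.
rewrite (sum_abel _ hs) (sum_abel _ ht) hsz opprD addrACA subrr add0r.
by rewrite -sumrB; apply: eq_bigr => j _; rewrite /a mulrBr !mulr_natr.
Qed.

(** This is [sum_excess_diff] for the identity, whose increments are all 1. *)
Lemma sum_excess : \sum_(1 <= j < D) a j = 0.
Proof.
transitivity (\sum_(1 <= j < D) (j.+1%:R - j%:R) * a j).
  by apply: eq_bigr => j _; rewrite -natrB // subSnn mul1r.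
by rewrite -(sum_excess_diff (fun j => j%:R)) -!natr_sum hsum subrr.
Qed.

(* Past the first level with at most k entries of s above it, s has fewer such
   entries than t, and before it more. *)
Lemma excess_single_crossing : exists2 m : nat, (0 < m)%N &
  (forall j, (0 < j < D)%N -> (j < m)%N -> 0 <= a j) /\
  (forall j, (0 < j < D)%N -> (m <= j)%N -> a j <= 0).
Proof.
have ex : exists j, (count (ltn j) s <= k)%N.
  exists D; rewrite (_ : count _ _ = 0)%N //; apply/eqP; rewrite -leqn0 leqNgt -has_count.
  by apply/hasPn => x /(allP hs) /andP[_ xD]; rewrite /= -leqNgt.
(* The least level may be 0, but the increments of [g] are compared only from 1 on, hence the
   maximum with 1. *)
case: (ex_minnP ex) => m mk mm; exists (maxn m 1); first lia.
split=> j jD jm.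
  rewrite subr_ge0 ler_nat; have := hk jD; have := mm j; lia.
rewrite subr_le0 ler_nat; have /andP[kt _] := hk jD; apply: leq_trans kt.
apply: leq_trans mk; apply: sub_count => x /=; lia.
Qed.

(** Since the excesses sum to zero, [d m] may be subtracted from every increment. At the crossing
    level [m] both factors then change sign together, so every term is nonnegative. *)
Lemma concave_sum_le (g : nat -> R) :
  (forall j, (0 < j)%N -> g j + g j.+2 <= 2 * g j.+1) ->
  \sum_(x <- t) g x <= \sum_(x <- s) g x /\
  ((forall j, (0 < j)%N -> g j + g j.+2 < 2 * g j.+1) ->
   \sum_(x <- s) g x = \sum_(x <- t) g x -> perm_eq s t).
Proof.
move=> cg; pose d j := g j.+1 - g j.
have dS j : (0 < j)%N -> d j.+1 <= d j by move/cg; rewrite /d; lra.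
have dle i n : (0 < i)%N -> d (i + n)%N <= d i.
  move=> i0; elim: n => [|n IH]; first by rewrite addn0.
  by rewrite addnS; apply: le_trans IH; apply: dS; lia.
have [m m0 [am ma]] := excess_single_crossing.
have E : \sum_(x <- s) g x - \sum_(x <- t) g x
    = \sum_(1 <= j < D) (d j - d m) * a j.
  under [RHS]eq_bigr do rewrite mulrBl.
  by rewrite sumrB -mulr_sumr sum_excess mulr0 subr0 sum_excess_diff.
have P j : (0 < j < D)%N -> 0 <= (d j - d m) * a j.
  move=> jD; have [jm|mj] := ltnP j m.
    apply: mulr_ge0; last exact: am.
    by rewrite subr_ge0 -(subnKC (ltnW jm)); apply: dle; lia.
  apply: mulr_le0; last exact: ma.
  by rewrite subr_le0 -(subnKC mj); exact: dle.
split; first by rewrite -subr_ge0 E big_nat; apply: sumr_ge0.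
move=> sg eq_st.
have dlt i j : (0 < i < j)%N -> d j < d i.
  move=> ij; rewrite (_ : j = i.+1 + (j - i.+1))%N; last lia.
  apply: le_lt_trans (dle i.+1 _ isT) _.
  have := sg i; rewrite /d; case/andP: ij => -> _ /(_ isT); lra.
have Z : all (fun j => (d j - d m) * a j == 0) (index_iota 1 D).
  move/eqP: E; rewrite eq_st subrr eq_sym big_seq psumr_eq0 => [|j]; last first.
    by rewrite mem_index_iota => /P.
  move/allP => Z; apply/allP => j jD; exact: implyP (Z j jD) jD.
(* Under strictness [d j] differs from [d m] for [j != m], so the excess vanishes there; the zero
   total then forces it to vanish at [m] as well. *)
have Zm j : (0 < j < D)%N -> j != m -> a j = 0.
  move=> jD jm; have := allP Z j; rewrite mem_index_iota => /(_ jD).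
  rewrite mulf_eq0 subr_eq0 => /orP[/eqP e|/eqP//].
  case: (ltngtP j m) jm => // jm _.
    by have := dlt j m; rewrite e ltxx jm; case/andP: jD => -> _ /(_ isT).
  by have := dlt m j; rewrite e ltxx jm m0 => /(_ isT).
have a0 j : (0 < j < D)%N -> a j = 0.
  move=> jD; have [E0|] := eqVneq j m; last exact: Zm.
  have := sum_excess; rewrite (bigD1_seq m) ?iota_uniq //=; last first.
    by rewrite mem_index_iota -E0.
  rewrite big_seq_cond big1 ?addr0 ?E0 // => i; rewrite mem_index_iota => /andP[iD im].
  exact: Zm.
apply: perm_eq_count_ltn => // j.
(* Level 0 counts all entries of either list, and the levels from [D] on count none. *)
have [->|j0] := posnP j.
  transitivity (size s); first by apply/eqP; rewrite -all_count; apply: sub_all hs => x /andP[].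
  by rewrite hsz; apply/esym/eqP; rewrite -all_count; apply: sub_all ht => x /andP[].
have [jD|Dj] := ltnP j D.
  have := a0 j; rewrite j0 jD => /(_ isT)/eqP; rewrite subr_eq0 eqr_nat.
  by move/eqP.
have H u : all (fun x => 0 < x <= D)%N u -> count (ltn j) u = 0%N.
  move=> hu; apply/eqP; rewrite -leqn0 leqNgt -has_count.
  by apply/hasPn => x /(allP hu) /andP[_ xD]; rewrite /= -leqNgt (leq_trans xD).
by rewrite !H.
Qed.

End Majorization.

(** * From lists back to degree sequences *)

Section DegreeSequence.
Variable G : sgraph.

Let s := [seq deg u | u : G].

Lemma degree_sequenceE (t : seq nat) : sorted geq t ->
  degree_sequence G = t <-> perm_eq s t.
Proof.
move=> st; split=> [<-|pst]; first by rewrite perm_sym perm_sort.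
have ttl : total geq by move=> x y; rewrite /geq /= leq_total.
have tr : transitive geq by move=> y x z /= yx zy; exact: leq_trans zy yx.
apply: (sorted_eq tr _ (sort_sorted ttl _) st); last by rewrite perm_sort.
by move=> x y /anti_leq.
Qed.

Lemma count_deg_ge2 : unicyclic G -> (3 <= count (ltn 1) s)%N.
Proof.
by move=> uG; rewrite -sum1_count big_image_cond sum1_card; exact: unicyclic_card_deg_ge2.
Qed.

(** The two cases of the theorem are instances of this, differing only in [t] and [k]. *)
Lemma I_f_extremal (R : realType) (f : R -> R) (D k : nat) (t : seq nat) :
  unicyclic G -> (1 < #|G|)%N -> maxdeg G = D -> concave f ->
  all (fun x => 0 < x <= D)%N t -> size t = #|G| -> (\sum_(x <- t) x = 2 * #|G|)%N ->
  sorted geq t ->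
  (forall j, (0 < j < D)%N ->
     (k <= count (ltn j) t <= maxn k.+1 (count (ltn j) s))%N) ->
  let b := \sum_(x <- t) f x%:R in
  [/\ b <= I_f f G, degree_sequence G = t -> I_f f G = b &
     strictly_concave f -> (I_f f G = b <-> degree_sequence G = t)].
Proof.
move=> uG G1 mG cf ht szt smt srt hk b.
have Is : I_f f G = \sum_(x <- s) f x%:R by rewrite big_image.
have hs : all (fun x => 0 < x <= D)%N s.
  apply/allP => x /imageP[u _ ->]; rewrite connected_deg_gt0 //; last by case: uG.
  by rewrite -mG leq_bigmax.
have szs : size s = size t by rewrite szt size_image.
have sms : (\sum_(x <- s) x = \sum_(x <- t) x)%N.
  by rewrite smt -unicyclic_sum_deg // big_image.
have [le_b eq_b] := concave_sum_le hs ht szs sms hk (fun j => @concave_midpoint R f j cf).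
have st_eq : degree_sequence G = t -> I_f f G = b.
  by move/(degree_sequenceE srt) => pst; rewrite Is; exact: perm_big.
rewrite Is; split=> // [|sf]; first by rewrite -Is.
split=> [e|]; last by rewrite -Is.
apply/(degree_sequenceE srt)/eq_b => // j; exact: strictly_concave_midpoint.
Qed.

End DegreeSequence.

(** * The extremal sequence *)

Lemma zseq_case1 (n D : nat) : (n %/ (D - 1))%N = 1%N \/ n = (2 * D - 2)%N ->
  zseq n D = [:: D, n - D + 1, 2 & nseq (n - 3) 1]%N.
Proof. by rewrite /zseq; case=> [->//|->]; rewrite eqxx orbT. Qed.

Lemma zseq_case2 (n D : nat) : (1 < n %/ (D - 1))%N -> n <> (2 * D - 2)%N ->
  let q := (n %/ (D - 1))%N in
  zseq n D = (nseq q D ++ (n - q * (D - 1) + 1) :: nseq (n - q - 1) 1)%N.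
Proof. by rewrite /zseq => q1 /eqP/negPf ->; rewrite gtn_eqF. Qed.

Lemma path_geq_nseq (m x c : nat) : (c <= x)%N -> path geq x (nseq m c).
Proof. by elim: m x => //= m IH x ->; exact: IH. Qed.

Lemma path_geq_nseq_cat (m x : nat) (w : seq nat) :
  path geq x w -> path geq x (nseq m x ++ w).
Proof. by move=> pw; elim: m => //= m ->; rewrite andbT. Qed.

Theorem theorem4p6 (R : realType) (G : sgraph) (n D q : nat) (f : R -> R)
  (hG : unicyclic G) (hn : #|G| = n) (hn4 : (4 <= n)%N)
  (hD : maxdeg G = D) (hD3 : (3 <= D)%N) (hq : q = (n %/ (D - 1))%N)
  (hf : concave f) :
  let bound1 := f D%:R + f (n%:R - D%:R + 1) + f 2 + (n%:R - 3) * f 1 in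
  let bound2 := q%:R * f D%:R + f (n%:R - q%:R * (D%:R - 1) + 1)
                + (n%:R - q%:R - 1) * f 1 in
  (q = 1%N \/ n = (2 * D - 2)%N ->
    [/\ bound1 <= I_f f G,
        in_K n D G -> I_f f G = bound1 &
        strictly_concave f -> (I_f f G = bound1 <-> in_K n D G)])
  /\
  ((1 < q)%N -> n <> (2 * D - 2)%N ->
    [/\ bound2 <= I_f f G,
        in_K n D G -> I_f f G = bound2 &
        strictly_concave f -> (I_f f G = bound2 <-> in_K n D G)]).
Proof.
move=> b1 b2.
have K : in_K n D G <-> degree_sequence G = zseq n D.
  by split=> [[]//|e]; split.
have G1 : (1 < #|G|)%N by lia.
have Dn : (D < n)%N.
  rewrite -hD; have [|u e] := bigop.eq_bigmax (@deg G); first lia.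
  by rewrite /maxdeg e -hn deg_lt_card.
(* Floor division puts [n - q * (D - 1) + 1] between 1 and [D - 1]. *)
have qd : (q * (D - 1) <= n)%N by rewrite hq leq_divM.
have nq : (n < q * (D - 1) + (D - 1))%N.
  by rewrite addnC -mulSn hq ltn_ceil //; lia.
split.
  move=> case1; have Z : zseq n D = [:: D, n - D + 1, 2 & nseq (n - 3) 1]%N.
    by apply: zseq_case1; rewrite -hq.
  (* Both alternatives give this bound, which keeps [n - D + 1] below [D]. *)
  have n2D : (n <= 2 * (D - 1))%N.
    by case: case1 => [q1|]; [move: nq; rewrite q1|]; lia.
  (* The bound subtracts in [R] and [zseq] in [nat]; they agree because [D < n] and [4 <= n]. *)
  have B : b1 = \sum_(x <- zseq n D) f x%:R.
    rewrite Z !big_cons big_nseq iter_addr_0 -[f _ *+ _]mulr_natl !addrA natrD !natrB //; lia.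
  have [] := @I_f_extremal G R f D 1 (zseq n D) hG G1 hD hf.
  - rewrite Z /=; apply/and4P; split; try lia.
    by apply/allP => x /nseqP[-> _]; lia.
  - rewrite Z /= size_nseq hn; lia.
  - rewrite Z !big_cons big_nseq iter_addn_0 hn; lia.
  - rewrite Z /= path_geq_nseq //; lia.
  - move=> j jD; rewrite Z /= count_nseq /=.
    have /andP[j0 ->] := jD; have -> : (j < 1)%N = false by lia.
    (* From level 2 on, one or two entries lie above. At level 1 there are three, more than
       [k + 1 = 2], so the three or more cycle vertices of [G] are needed. *)
    have [->|j1] := eqVneq j 1%N; last lia.
    by have := count_deg_ge2 hG; lia.
  by rewrite -B => *; split=> // [/K|] //; rewrite K.
move=> q1 nD.
have Z : zseq n D = (nseq q D ++ (n - q * (D - 1) + 1) :: nseq (n - q - 1) 1)%N.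
  by rewrite hq; apply: zseq_case2; rewrite -?hq.
(* As [D - 1] is at least 2, [2 * q <= n]; so [n - q - 1] is not truncated. *)
have qn : (q < n)%N by nia.
have B : b2 = \sum_(x <- zseq n D) f x%:R.
  rewrite Z big_cat big_cons !big_nseq !iter_addr_0 -![f _ *+ _]mulr_natl /= !addrA.
  by rewrite natrD !natrB ?natrM ?natrB //; lia.
have [] := @I_f_extremal G R f D q (zseq n D) hG G1 hD hf.
- rewrite Z all_cat /=; apply/and3P; split; try lia.
    by apply/allP => x /nseqP[-> _]; lia.
  by apply/allP => x /nseqP[-> _]; lia.
- by rewrite Z size_cat /= !size_nseq hn; lia.
- rewrite Z big_cat big_cons !big_nseq !iter_addn_0 /= hn; nia.
- have rD : (n - q * (D - 1) + 1 <= D)%N by lia.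
  rewrite Z; case: (q) q1 rD => // m _ rD /=.
  by apply: path_geq_nseq_cat; rewrite /= rD path_geq_nseq //; lia.
(* The [q] copies of [D] always lie above [j], and at most one further entry does, whence
   [k = q]. *)
- move=> j jD; rewrite Z count_cat /= !count_nseq /=.
  have /andP[j0 ->] := jD; have -> : (j < 1)%N = false by lia.
  by rewrite mul1n mul0n; case: (j < _)%N; lia.
by rewrite -B => *; split=> // [/K|] //; rewrite K.
Qed.
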